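(* For any positive integers $r$, $d$, and $t$ with $t\geq 2r$, $$bc_{2d}(\mathrm{KG}(t,r)) \leq N((r,r;d),t) \leq 2\, bc_d(\mathrm{KG}(t,r)).$$
   Context: All graphs are finite and simple; $[t]=\{1,\ldots,t\}$. Kneser graph. The vertices of $\mathrm{KG}(t,r)$ are the $r$-element subsets of $[t]$; two distinct vertices $A,B$ are adjacent iff $A\cap B=\varnothing$. Biclique covers. A biclique is a bipartite graph with parts $(X,Y)$ in which every vertex of $X$ is adjacent to every vertex of $Y$; edgeless graphs are also regarded as bicliques. A $d$-biclique cover of size $s$ of a graph $G$ is a collection (family, repetitions allowed) of $s$ bicliques that are subgraphs (not necessarily induced) of $G$ such that each edge of $G$ is in at least $d$ of them. $bc_d(G)$ is the minimum $s$ for which a $d$-biclique cover of $G$ of size $s$ exists. Cover-free families. Let $X$ be a finite set with $n$ elements and $\mathcal F=\{B_1,\ldots,B_t\}$ an (indexed) family of $t$ subsets of $X$. $\mathcal F$ is an $(r,w;d)$-cover-free family if for all $I,J\subseteq[t]$ with $|I|=r$, $|J|=w$, $I\cap J=\varnothing$, the set $\bigcap_{i\in I}B_i\setminus\bigcup_{j\in J}B_j$ has at least $d$ elements. $N((r,w;d),t)$ is the minimum $n$ for which there exists an $(r,w;d)$-cover-free family of $t$ subsets of an $n$-element set. *)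

(* Defs.v *)
From mathcomp Require Import all_boot.

Set Implicit Arguments.
Unset Strict Implicit.
Unset Printing Implicit Defensive.

Record sgraph := SGraph {
  vertex :> finType;
  adj : rel vertex;
  adj_sym : symmetric adj;
  adj_irrefl : irreflexive adj }.

Section Kneser.
Variables t r : nat.

Definition kneser_vertex : finType := {A : {set 'I_t} | #|A| == r}.

Definition kneser_adj : rel kneser_vertex :=
  fun A B => (A != B) && [disjoint val A & val B].

Lemma kneser_adj_sym : symmetric kneser_adj.
Proof. by move=> A B; rewrite /kneser_adj eq_sym disjoint_sym. Qed.

Lemma kneser_adj_irrefl : irreflexive kneser_adj.
Proof. by move=> A; rewrite /kneser_adj eqxx. Qed.

Definition KG : sgraph := SGraph kneser_adj_sym kneser_adj_irrefl.
End Kneser.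

Section BicliqueCover.
Variable G : sgraph.

(* A pair (X, Y) stands for the complete bipartite graph with parts X and Y;
   an edgeless graph on V is the pair (V, set0). *)
Definition biclique_adj (K : {set G} * {set G}) : rel G :=
  fun u v => ((u \in K.1) && (v \in K.2)) || ((u \in K.2) && (v \in K.1)).

Definition biclique_in (K : {set G} * {set G}) : bool :=
  [disjoint K.1 & K.2] &&
  [forall u : G, forall v : G, biclique_adj K u v ==> adj u v].

Definition biclique_cover (d s : nat)
    (C : {ffun 'I_s -> {set G} * {set G}}) : bool :=
  [forall i, biclique_in (C i)] &&
  [forall u : G, forall v : G,
     adj u v ==> (d <= #|[set i | biclique_adj (C i) u v]|)].

Definition has_biclique_cover (d : nat) : pred nat :=
  fun s => [exists C : {ffun 'I_s -> {set G} * {set G}}, biclique_cover d C].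

(* Take d copies of every single edge. *)
Lemma biclique_cover_exists d : exists s, has_biclique_cover d s.
Proof.
pose I : finType := (G * G * 'I_d)%type.
pose K (x : I) : {set G} * {set G} :=
  if adj x.1.1 x.1.2 then ([set x.1.1], [set x.1.2]) else (set0, set0).
exists #|I|; apply/existsP.
exists [ffun i : 'I_#|I| => K (enum_val i)].
apply/andP; split.
  apply/forallP => i; rewrite ffunE /K.
  case: ifP => uv; last first.
    rewrite /biclique_in -setI_eq0 setI0 eqxx /=.
    by apply/'forall_forallP => u v; rewrite /biclique_adj !inE.
  apply/andP; split=> /=.
    rewrite disjoints1 inE; apply: contraTneq uv => ->.
    by rewrite adj_irrefl.
  apply/'forall_forallP => u v; apply/implyP.
  by rewrite /biclique_adj !inE => /orP[] /andP[/eqP-> /eqP->] //;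
    rewrite adj_sym.
apply/'forall_forallP => u v; apply/implyP => uv.
pose h (k : 'I_d) : 'I_#|I| := enum_rank ((u, v, k) : I).
have h_inj : injective h by move=> k l /enum_rank_inj[].
rewrite -[leqLHS]card_ord -(card_imset predT h_inj).
apply/subset_leq_card/subsetP => _ /imsetP[k _ ->].
by rewrite inE ffunE enum_rankK /K /= uv /biclique_adj !inE !eqxx.
Qed.

Definition bc (d : nat) : nat := ex_minn (biclique_cover_exists d).
End BicliqueCover.

Section CoverFree.
Variables r w d t : nat.

Definition cover_free (n : nat) (B : {ffun 'I_t -> {set 'I_n}}) : bool :=
  [forall I : {set 'I_t}, forall J : {set 'I_t},
     [&& #|I| == r, #|J| == w & [disjoint I & J]] ==>
     (d <= #|(\bigcap_(i in I) B i) :\: (\bigcup_(j in J) B j)|)].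

Definition has_cover_free : pred nat :=
  fun n => [exists B : {ffun 'I_t -> {set 'I_n}}, cover_free B].

(* On d copies of the power set of the index set, let B_i be the set of all
   copies of the subsets containing i. *)
Lemma cover_free_exists : exists n, has_cover_free n.
Proof.
pose X : finType := ({set 'I_t} * 'I_d)%type.
exists #|X|; apply/existsP.
exists [ffun i : 'I_t => [set x : 'I_#|X| | i \in (enum_val x).1]].
apply/'forall_forallP => I J; apply/implyP => /and3P[_ _ dIJ].
pose h (k : 'I_d) : 'I_#|X| := enum_rank ((I, k) : X).
have h_inj : injective h by move=> k l /enum_rank_inj[].
rewrite -[leqLHS]card_ord -(card_imset predT h_inj).
apply/subset_leq_card/subsetP => _ /imsetP[k _ ->].
rewrite inE; apply/andP; split.
  apply/negP => /bigcupP[j Jj].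
  by rewrite ffunE inE enum_rankK /= (disjointFl dIJ Jj).
by apply/bigcapP => i Ii; rewrite ffunE inE enum_rankK.
Qed.

(* N((r, w; d), t) *)
Definition cover_free_N : nat := ex_minn cover_free_exists.
End CoverFree.

(* Main.v *)
Require Import Defs.
From mathcomp Require Import all_boot.

(** A family of subsets [B_i] of a set of points is the same data as a family
    of subsets of the index set: a point [x] has the dual set
    [P_x = {i | x \in B_i}], and [x] lies in every [B_i] with [i \in I] and in
    no [B_j] with [j \in J] exactly when [P_x] contains [I] and misses [J].
    Read this way, a point separates ordered pairs of disjoint r-sets
    ([separators_cover_free], [cover_free_separators]), whereas a biclique of
    the Kneser graph covers unordered ones.

    A point gives a biclique: the r-sets inside [P_x] against the r-sets
    outside [P_x]. It covers the edge [IJ] when [x] separates [I] from [J] or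
    [J] from [I]. For [r > 0] no point does both, so the d points of each kind
    give 2d bicliques through the edge; this is [cover_free_to_biclique].

    A biclique with parts [(X, Y)] gives two points, whose dual sets are the
    union of the members of [X] and that of the members of [Y]. Each member of
    [X] is disjoint from each member of [Y], so the first point separates any
    member of [X] from any member of [Y], and the second does the reverse.
    Hence each biclique through [IJ] contributes a point that separates [I]
    from [J], whichever side [I] is on; this is [biclique_to_cover_free]. *)

Set Implicit Arguments.
Unset Strict Implicit.
Unset Printing Implicit Defensive.

Section Separators.
Variables (t : nat) (X : finType) (P : X -> {set 'I_t}).

Definition separators (I J : {set 'I_t}) : {set X} :=
  [set x | (I \subset P x) && [disjoint P x & J]].

(** A common point would have a dual set that both contains and misses [I].
    This is what turns d separators into 2d bicliques. *)
Lemma disjoint_separators (I J : {set 'I_t}) :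
  I != set0 -> [disjoint separators I J & separators J I].
Proof.
case/set0Pn=> i Ii; rewrite -setI_eq0; apply/eqP/setP=> x; rewrite !inE.
apply/negP=> /andP[/andP[/subsetP sIP _] /andP[_ dPI]].
by have := sIP i Ii; rewrite (disjointFl dPI Ii).
Qed.

(** The points may form any finite type, which spares explicit arithmetic on
    their indices when they come in pairs. *)
Lemma separators_cover_free (r w d : nat) :
  (forall I J : {set 'I_t}, #|I| = r -> #|J| = w -> [disjoint I & J] ->
     d <= #|separators I J|) ->
  has_cover_free r w d t #|X|.
Proof.
move=> sepP; apply/existsP.
exists [ffun i : 'I_t => [set k : 'I_#|X| | i \in P (enum_val k)]].
apply/'forall_forallP=> I J; apply/implyP=> /and3P[/eqP cI /eqP cJ dIJ].
apply: leq_trans (sepP I J cI cJ dIJ) _.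
rewrite -(card_imset _ (@enum_rank_inj X)).
apply/subset_leq_card/subsetP=> _ /imsetP[x + ->].
rewrite inE => /andP[sIP dPJ].
rewrite inE; apply/andP; split.
  apply/bigcupP=> -[j Jj]; rewrite ffunE inE enum_rankK.
  by rewrite (disjointFl dPJ Jj).
by apply/bigcapP=> i Ii; rewrite ffunE inE enum_rankK (subsetP sIP).
Qed.

End Separators.

Lemma cover_free_separators (r w d t n : nat) :
  has_cover_free r w d t n ->
  exists P : 'I_n -> {set 'I_t},
    forall I J : {set 'I_t}, #|I| = r -> #|J| = w -> [disjoint I & J] ->
      d <= #|separators P I J|.
Proof.
case/existsP=> B /'forall_forallP cfB.
exists (fun x => [set i | x \in B i]) => I J cI cJ dIJ.
have := cfB I J; rewrite cI cJ !eqxx dIJ /= => /leq_trans; apply.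
apply/subset_leq_card/subsetP=> x; rewrite !inE => /andP[xJ /bigcapP xI].
apply/andP; split; first by apply/subsetP=> i /xI; rewrite inE.
rewrite disjoint_sym disjoint_subset; apply/subsetP=> j Jj; rewrite !inE.
by apply: contra xJ => xBj; apply/bigcupP; exists j.
Qed.

Section KneserBicliques.
Variables t r : nat.

(** A nonempty set meets itself, so for [r > 0] disjoint vertices are
    distinct. *)
Lemma kneser_adjE (u v : KG t r) :
  0 < r -> adj u v = [disjoint val u & val v].
Proof.
move=> r_gt0; rewrite /= /kneser_adj; case: eqVneq => //= <-.
apply/esym/negbTE; rewrite -setI_eq0 setIid -card_gt0.
by rewrite (eqP (valP u)).
Qed.

Definition split_biclique (A : {set 'I_t}) : {set KG t r} * {set KG t r} :=
  ([set u : KG t r | val u \subset A],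
   [set u : KG t r | [disjoint A & val u]]).

Lemma split_biclique_in (A : {set 'I_t}) :
  0 < r -> biclique_in (split_biclique A).
Proof.
move=> r_gt0.
have dis (u v : KG t r) :
    val u \subset A -> [disjoint A & val v] -> [disjoint val u & val v].
  by move=> sA; apply: disjointWl.
apply/andP; split.
  rewrite -setI_eq0 /=; apply/eqP/setP=> u; rewrite !inE.
  apply/negP=> /andP[uA Au].
  by have := dis u u uA Au; rewrite -kneser_adjE // adj_irrefl.
apply/'forall_forallP=> u v; apply/implyP.
rewrite /biclique_adj !inE kneser_adjE // => /orP[] /andP[uA vA].
  exact: dis uA vA.
by rewrite disjoint_sym; apply: dis vA uA.
Qed.

Lemma cover_free_to_biclique (d n : nat) :
  0 < r -> has_cover_free r r d t n -> has_biclique_cover (KG t r) (2 * d) n.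
Proof.
move=> r_gt0 /cover_free_separators[P sepP]; apply/existsP.
exists [ffun x => split_biclique (P x)]; apply/andP; split.
  by apply/forallP=> x; rewrite ffunE split_biclique_in.
apply/'forall_forallP=> u v; apply/implyP; rewrite kneser_adjE // => duv.
have cu := eqP (valP u); have cv := eqP (valP v).
have -> : [set x | biclique_adj ([ffun x => split_biclique (P x)] x) u v]
    = separators P (val u) (val v) :|: separators P (val v) (val u).
  apply/setP=> x; rewrite !inE ffunE /biclique_adj !inE.
  by rewrite [X in _ || X]andbC.
have u_neq0 : val u != set0 by rewrite -card_gt0 cu.
rewrite cardsU (disjoint_setI0 (disjoint_separators P (val v) u_neq0)).
rewrite cards0 subn0 mul2n -addnn leq_add ?sepP //.
by rewrite disjoint_sym.
Qed.

Lemma biclique_bigcup_disjoint (K : {set KG t r} * {set KG t r}) (v : KG t r) :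
  0 < r -> biclique_in K -> v \in K.2 ->
  [disjoint \bigcup_(u in K.1) val u & val v].
Proof.
move=> r_gt0 /andP[_ /'forall_forallP adjK] vK2.
rewrite -setI_eq0 big_distrl /=; apply/eqP/big1=> u uK1.
apply/disjoint_setI0; rewrite -kneser_adjE //.
by apply: (implyP (adjK u v)); rewrite /biclique_adj uK1 vK2.
Qed.

Lemma biclique_in_swap (K : {set KG t r} * {set KG t r}) :
  biclique_in K -> biclique_in (K.2, K.1).
Proof.
case/andP=> dK /'forall_forallP adjK; apply/andP; split.
  by rewrite disjoint_sym.
apply/'forall_forallP=> u v; rewrite /biclique_adj /= orbC; exact: adjK.
Qed.

Lemma biclique_to_cover_free (d s : nat) :
  0 < r -> has_biclique_cover (KG t r) d s -> has_cover_free r r d t (2 * s).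
Proof.
move=> r_gt0 /existsP[C /andP[/forallP inC /'forall_forallP coverC]].
pose part (x : bool * 'I_s) := if x.1 then (C x.2).1 else (C x.2).2.
pose P x : {set 'I_t} := \bigcup_(u in part x) val u.
suff: has_cover_free r r d t #|{: bool * 'I_s}|.
  by rewrite card_prod card_bool card_ord.
apply: (@separators_cover_free _ _ P) => I J cI cJ dIJ.
pose u : KG t r := Sub I (introT eqP cI).
pose v : KG t r := Sub J (introT eqP cJ).
have := coverC u v; rewrite kneser_adjE // dIJ => /leq_trans; apply.
(* From each biclique through the edge, keep the point of the part that
   contains I. *)
pose h k : bool * 'I_s := (u \in (C k).1, k).
have h_inj : injective h by move=> k l [].
rewrite -(card_imset _ h_inj).
apply/subset_leq_card/subsetP=> _ /imsetP[k + ->].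
rewrite inE => adj_uv.
have sep K : biclique_in K -> u \in K.1 -> v \in K.2 ->
    (I \subset \bigcup_(w in K.1) val w)
    && [disjoint \bigcup_(w in K.1) val w & J].
  move=> inK uK vK; apply/andP; split; first exact: (bigcup_sup u).
  exact: (biclique_bigcup_disjoint (v := v)).
rewrite inE /P /part /h /=.
have [uC1 | uC1] := boolP (u \in (C k).1); last first.
  move: adj_uv; rewrite /biclique_adj (negPf uC1) /= => /andP[uC2 vC1].
  exact: sep (biclique_in_swap (inC k)) uC2 vC1.
(* As the parts are disjoint, J is then on the other side. *)
have uC2 : u \in (C k).2 = false.
  by case/andP: (inC k) => dC _; rewrite (disjointFr dC).
move: adj_uv; rewrite /biclique_adj uC1 uC2 orbF => vC2.
exact: sep (inC k) uC1 vC2.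
Qed.

End KneserBicliques.

Theorem theorem2 (r d t : nat) (hr : 0 < r) (hd : 0 < d) (ht : 0 < t)
    (h2r : 2 * r <= t) :
  bc (KG t r) (2 * d) <= cover_free_N r r d t
    /\ cover_free_N r r d t <= 2 * bc (KG t r) d.
Proof.
rewrite /bc /cover_free_N; split.
  case: ex_minnP => m _ min_m; case: ex_minnP => n cf_n _.
  exact/min_m/cover_free_to_biclique.
case: ex_minnP => n _ min_n; case: ex_minnP => s bc_s _.
exact/min_n/biclique_to_cover_free.
Qed.
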